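(* Let $X$ be a three-point subset of the unit sphere $\mathbb{S}^2\subset\mathbb{R}^3$. (i) If the affine span of $X$ does not contain the origin, then $X$ is spherical sub-$p$-toral for all sufficiently large primes $p$. (ii) Suppose $X$ lies on the great circle $\mathbb{S}^1=\mathbb{S}^2\cap(\mathbb{R}^2\times\{0\})$. Then $X$ is spherical sub-$p$-toral for some prime $p$ if and only if either $X$ is the vertex set of a right-angled triangle, or there is a prime $p$ such that $X$ is contained in a single orbit of the standard action of $\mathbb{Z}_p$ on $\mathbb{S}^1$ (generated by rotation by angle $2\pi/p$).
   Context: A $p$-torus is a group $G\cong(\mathbb{Z}_p)^\alpha$, $\alpha\ge1$. A set $X\subset\mathbb{S}^{k-1}$ (unit sphere of $\mathbb{R}^k$) is spherical sub-$p$-toral if there exist $n\ge k$, a $p$-torus $G$ and an orthogonal linear action of $G$ on $\mathbb{R}^n$ such that $X$, viewed in $\mathbb{S}^{n-1}$ via the standard inclusion $\mathbb{R}^k\subset\mathbb{R}^n$, is contained in a single $G$-orbit. *)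

(* Defs.v *)
From HB Require Import structures.
From mathcomp Require Import all_boot all_order all_algebra.
From mathcomp Require Import all_classical all_reals all_analysis.
Set Implicit Arguments. Unset Strict Implicit. Unset Printing Implicit Defensive.
Import Order.TTheory GRing.Theory Num.Theory.
Local Open Scope ring_scope.

Definition dot {R : realType} {k : nat} (u v : 'rV[R]_k) : R :=
  \sum_(i < k) u ord0 i * v ord0 i.

(* X (a subset of R^k, given as a predicate) is spherical sub-p-toral:
   there are n = k + m >= k, a p-torus G = ('Z_p)^alpha (alpha >= 1, realised as
   the additive group 'rV['Z_p]_alpha), an orthogonal linear action of G on R^n
   (a homomorphism rho into orthogonal n x n matrices, acting on row vectors
   by x |-> x *m rho g), and a point x0 whose G-orbit contains the image of X
   under the standard inclusion R^k -> R^n, x |-> (x, 0). *)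
Definition sub_p_toral {R : realType} (p k : nat) (X : 'rV[R]_k -> Prop) : Prop :=
  exists (m alpha : nat), (0 < alpha)%N /\
  exists rho : 'rV['Z_p]_alpha -> 'M[R]_(k + m),
    (forall g h, rho (g + h) = rho g *m rho h) /\
    (forall g, rho g *m (rho g)^T = 1%:M) /\
    exists x0 : 'rV[R]_(k + m),
      forall x, X x -> exists g, row_mx x (0 : 'rV[R]_m) = x0 *m rho g.

Definition i3 : 'I_3 := @Ordinal 3 2 isT.

(* rotation of R^3 about the third axis by angle t, acting on row vectors:
   (x, y, z) *m rotz t = (x cos t - y sin t, x sin t + y cos t, z) *)
Definition rotz {R : realType} (t : R) : 'M[R]_3 :=
  \matrix_(i < 3, j < 3)
    match nat_of_ord i, nat_of_ord j with
    | 0, 0 => cos t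
    | 0, 1 => sin t
    | 1, 0 => - sin t
    | 1, 1 => cos t
    | 2, 2 => 1
    | _, _ => 0
    end.

Definition right_triangle {R : realType} (a b c : 'rV[R]_3) : Prop :=
  dot (b - a) (c - a) = 0 \/ dot (a - b) (c - b) = 0 \/ dot (a - c) (b - c) = 0.

(* Main.v *)
Require Import Defs.
From HB Require Import structures.
From mathcomp Require Import all_boot all_order all_algebra.
From mathcomp Require Import all_classical all_reals all_analysis.
From mathcomp Require Import ring lra complex.
Import Order.TTheory GRing.Theory Num.Theory.
Local Open Scope ring_scope.

(* Being spherical sub-p-toral depends only on the Gram matrix of the triple.
   With unit diagonal, the off-diagonal triples (x, y, z) realised by orbits of
   p-tori form a convex set containing (cos s, cos t, cos (s - t)) for s, t
   multiples of 2 pi / p. Averaging s, t and s, -t shows that it contains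
   (cos s, cos t, z) as soon as the Gram determinant is positive, and an
   interior triple (x, y, z) is then reached by convexity in x and y, once the
   grid is fine enough.
   If the triple lies on a circle and has no antipodal pair, then
   c = l a + m b with l, m nonzero. A common complex eigenvector of the two group
   elements moving a to b and c yields p-th roots of unity w and l + m w, and
   l, m determine w up to conjugation, so that a, b, c themselves lie in an orbit
   of the standard action. An antipodal pair (equivalently, by Thales, a right
   angle) is dealt with by the 2-torus generated by -1 and a reflection. *)

Set Implicit Arguments.
Unset Strict Implicit.

(** * Gram matrices and reflections *)

Section Dot.
Context {R : realType}.

Lemma dotE k (u v : 'rV[R]_k) : dot u v = (u *m v^T) ord0 ord0.
Proof. by rewrite mxE; apply: eq_bigr => i _; rewrite mxE. Qed.

Lemma dotC k (u v : 'rV[R]_k) : dot u v = dot v u.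
Proof. by apply: eq_bigr => i _; rewrite mulrC. Qed.

Lemma dotDl k (u v w : 'rV[R]_k) : dot (u + v) w = dot u w + dot v w.
Proof. by rewrite !dotE mulmxDl mxE. Qed.

Lemma dotZl k t (u v : 'rV[R]_k) : dot (t *: u) v = t * dot u v.
Proof. by rewrite !dotE -scalemxAl mxE. Qed.

Lemma dotNl k (u v : 'rV[R]_k) : dot (- u) v = - dot u v.
Proof. by rewrite !dotE mulNmx mxE. Qed.

Lemma dotDr k (u v w : 'rV[R]_k) : dot u (v + w) = dot u v + dot u w.
Proof. by rewrite !(dotC u) dotDl. Qed.

Lemma dotZr k t (u v : 'rV[R]_k) : dot u (t *: v) = t * dot u v.
Proof. by rewrite !(dotC u) dotZl. Qed.

Lemma dotNr k (u v : 'rV[R]_k) : dot u (- v) = - dot u v.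
Proof. by rewrite !(dotC u) dotNl. Qed.

Definition dot_lin := (@dotDl, @dotDr, @dotNl, @dotNr, @dotZl, @dotZr).

Lemma dot0l k (u : 'rV[R]_k) : dot 0 u = 0.
Proof. by rewrite dotE mul0mx mxE. Qed.

Lemma dot_ge0 k (u : 'rV[R]_k) : 0 <= dot u u.
Proof. by apply: sumr_ge0 => i _; rewrite -expr2 sqr_ge0. Qed.

Lemma dot_eq0 k (u : 'rV[R]_k) : dot u u = 0 -> u = 0.
Proof.
move/psumr_eq0P => u0; apply/rowP => i; rewrite mxE.
by apply/eqP; rewrite -sqrf_eq0 expr2 u0 // => j _; rewrite -expr2 sqr_ge0.
Qed.

Lemma dot_mul_orth k (Q : 'M[R]_k) (u v : 'rV[R]_k) :
  Q *m Q^T = 1%:M -> dot (u *m Q) (v *m Q) = dot u v.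
Proof. by move=> oQ; rewrite !dotE trmx_mul mulmxA -(mulmxA u) oQ mulmx1. Qed.

Lemma dot_row_mx k m (a c : 'rV[R]_k) (b d : 'rV[R]_m) :
  dot (row_mx a b) (row_mx c d) = dot a c + dot b d.
Proof. by rewrite !dotE tr_row_mx mul_row_col mxE. Qed.

Lemma unit_antipodal k (u v : 'rV[R]_k) :
  dot u u = 1 -> dot v v = 1 -> dot u v = -1 -> v = - u.
Proof.
move=> uu vv uv; apply/eqP; rewrite eq_sym -subr_eq0 -opprD oppr_eq0; apply/eqP.
by apply: dot_eq0; rewrite !dot_lin (dotC v u) uu vv uv; ring.
Qed.

Lemma unit_eq k (u v : 'rV[R]_k) :
  dot u u = 1 -> dot v v = 1 -> dot u v = 1 -> u = v.
Proof.
move=> uu vv uv; apply/eqP; rewrite -subr_eq0; apply/eqP.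
by apply: dot_eq0; rewrite !dot_lin (dotC v u) uu vv uv; ring.
Qed.

(* For [w = 0] this is the identity, since [2 / 0 = 0]. *)
Definition reflection k (w : 'rV[R]_k) : 'M[R]_k :=
  1%:M - (2 / dot w w) *: (w^T *m w).

Lemma reflection_tr k (w : 'rV[R]_k) : (reflection w)^T = reflection w.
Proof. by rewrite /reflection linearB /= linearZ /= trmx_mul trmxK trmx1. Qed.

Lemma mul_reflection k (u w : 'rV[R]_k) :
  u *m reflection w = u - (2 * dot u w / dot w w) *: w.
Proof.
rewrite /reflection mulmxBr mulmx1 -scalemxAr mulmxA.
rewrite [u *m w^T]mx11_scalar mul_scalar_mx -dotE scalerA.
by congr (_ - _ *: _); ring.
Qed.

Lemma reflectionK k (w : 'rV[R]_k) : reflection w *m reflection w = 1%:M.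
Proof.
apply/row_matrixP => i; rewrite !rowE mulmxA mulmx1.
move: (delta_mx _ _) => u; rewrite (mul_reflection u) mulmxBl -scalemxAl.
rewrite !mul_reflection.
have [->|w0] := eqVneq w 0; first by rewrite !(scaler0, subr0).
have ww : dot w w != 0 by apply: contraNneq w0 => /dot_eq0 ->.
rewrite mulfK // scalerBr scalerA; apply/rowP => j; rewrite !mxE; ring.
Qed.

Lemma reflection_fix k (u w : 'rV[R]_k) : dot u w = 0 -> u *m reflection w = u.
Proof. by move=> uw; rewrite mul_reflection uw mulr0 mul0r scale0r subr0. Qed.

Lemma reflection_swap k (u v : 'rV[R]_k) :
  dot u u = dot v v -> u *m reflection (u - v) = v.
Proof.
move=> uv; rewrite mul_reflection.
(* Equal norms make the coefficient of [u - v] in the reflection formula equal to 1. The case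
   [u = v], where the quotient degenerates, is treated apart. *)
have E : 2 * dot u (u - v) = dot (u - v) (u - v).
  by rewrite !dot_lin (dotC v u) -uv; ring.
have [/dot_eq0 w0|w0] := eqVneq (dot (u - v) (u - v)) 0.
  by rewrite w0 scaler0 subr0; apply/eqP; rewrite -subr_eq0 w0.
by rewrite E divff // scale1r opprB addrC subrK.
Qed.

(* Reflect the vectors into place one after the other: equality of the Gram
   matrices makes each reflection fix the vectors already placed. *)
Lemma orthogonal_extension k N (u v : nat -> 'rV[R]_k) :
  (forall i j, (i < N)%N -> (j < N)%N -> dot (u i) (u j) = dot (v i) (v j)) ->
  exists2 Q : 'M[R]_k, Q *m Q^T = 1%:M & forall i, (i < N)%N -> u i *m Q = v i.
Proof.
elim: N => [_|N IH uv]; first by exists 1%:M; rewrite ?trmx1 ?mulmx1.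
have [i j iN jN|Q oQ Qu] := IH; first by apply: uv; exact: ltnW.
exists (Q *m reflection (u N *m Q - v N)).
  by rewrite trmx_mul reflection_tr mulmxA -(mulmxA Q) reflectionK mulmx1.
move=> i; rewrite ltnS leq_eqVlt mulmxA => /predU1P[->|iN].
  by rewrite reflection_swap // dot_mul_orth // uv.
rewrite Qu // reflection_fix // dotDr dotNr -uv ?(ltnW iN) //; last exact: ltnW.
by rewrite -(Qu _ iN) dot_mul_orth // subrr.
Qed.

End Dot.

(** * Rotations and orthogonal representations *)

Section Rotation.
Context {R : realType}.

Lemma rotzD (s t : R) : rotz (s + t) = rotz s *m rotz t.
Proof.
apply/matrixP => i j; rewrite !mxE !big_ord_recl big_ord0 !mxE cosD sinD.
by case: i j => [[|[|[|//]]] hi] [[|[|[|//]]] hj] /=; ring.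
Qed.

Lemma rotz0 : rotz (0 : R) = 1%:M.
Proof.
apply/matrixP => i j; rewrite !mxE cos0 sin0 oppr0.
by case: i j => [[|[|[|//]]] hi] [[|[|[|//]]] hj] /=.
Qed.

Lemma rotzN (t : R) : rotz (- t) = (rotz t)^T.
Proof.
apply/matrixP => i j; rewrite !mxE cosN sinN opprK.
by case: i j => [[|[|[|//]]] hi] [[|[|[|//]]] hj] /=.
Qed.

Lemma rotz_orth (t : R) : rotz t *m (rotz t)^T = 1%:M.
Proof. by rewrite -rotzN -rotzD subrr rotz0. Qed.

Lemma rotzX (t : R) k : rotz t ^+ k = rotz (t * k%:R).
Proof.
elim: k => [|k IH]; first by rewrite mulr0 rotz0.
by rewrite exprS IH -[LHS]rotzD; congr rotz; rewrite -natr1; ring.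
Qed.

Lemma cos_2pi_nat k : cos (2 * pi * k%:R : R) = 1.
Proof.
by rewrite mulr_natr mulr_natl -[X in cos X]add0r (periodicn (@cosD2pi R)) cos0.
Qed.

Lemma sin_2pi_nat k : sin (2 * pi * k%:R : R) = 0.
Proof.
by rewrite mulr_natr mulr_natl -[X in sin X]add0r (periodicn (@sinD2pi R)) sin0.
Qed.

Lemma rotz_2pi_nat k : rotz (2 * pi * k%:R : R) = 1%:M.
Proof.
by rewrite -rotz0; apply/matrixP => i j; rewrite !mxE cos_2pi_nat sin_2pi_nat cos0 sin0.
Qed.

Lemma rotz_order p j : (0 < p)%N -> rotz (2 * pi * j%:R / p%:R : R) ^+ p = 1%:M.
Proof.
by move=> p0; rewrite rotzX divfK ?rotz_2pi_nat // pnatr_eq0 -lt0n.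
Qed.

Lemma rotzNX (t : R) k : rotz t ^+ k = 1%:M -> rotz (- t) ^+ k = 1%:M.
Proof. by rewrite !rotzX mulNr rotzN => ->; rewrite trmx1. Qed.

Lemma dot_delta_rotz (s t : R) :
  dot (delta_mx ord0 ord0 *m rotz s) (delta_mx ord0 ord0 *m rotz t) = cos (s - t).
Proof.
rewrite -!rowE /dot !big_ord_recl big_ord0 !mxE /= cosB.
by rewrite mul0r !addr0.
Qed.

Lemma mul_rotz (u : 'rV[R]_3) (t : R) (v : 'rV[R]_3) :
  v ord0 ord0 = u ord0 ord0 * cos t - u ord0 (lift ord0 ord0) * sin t ->
  v ord0 (lift ord0 ord0) = u ord0 ord0 * sin t + u ord0 (lift ord0 ord0) * cos t ->
  v ord0 i3 = u ord0 i3 -> v = u *m rotz t.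
Proof.
move=> v0 v1 v2; apply/rowP => j.
rewrite mxE !big_ord_recl big_ord0 !mxE.
have E2 : lift ord0 (lift ord0 ord0) = i3 by apply: val_inj.
rewrite E2; case: j => [[|[|[|//]]] hj] /=.
- rewrite (_ : Ordinal hj = ord0) ?v0; last exact: val_inj.
  by ring.
- rewrite (_ : Ordinal hj = lift ord0 ord0) ?v1; last exact: val_inj.
  by ring.
- rewrite (_ : Ordinal hj = i3) ?v2; last exact: val_inj.
  by ring.
Qed.

End Rotation.

Section Rep.
Context {R : realType}.

Definition orth_rep p alpha n (rho : 'rV['Z_p]_alpha -> 'M[R]_n) : Prop :=
  (forall g h, rho (g + h) = rho g *m rho h) /\
  (forall g, rho g *m (rho g)^T = 1%:M).

Section OrthRep.
Variables (p alpha n : nat) (rho : 'rV['Z_p]_alpha -> 'M[R]_n).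
Hypothesis rep : orth_rep rho.

Lemma orth_rep0 : rho 0 = 1%:M.
Proof.
have /(congr1 (mulmx^~ (rho 0)^T)) := rep.1 0 0.
by rewrite addr0 -mulmxA !rep.2 mulmx1.
Qed.

Lemma orth_repX g k : rho (g *+ k) = rho g ^+ k.
Proof. by elim: k => [|k IH]; rewrite ?orth_rep0 // mulrS rep.1 IH exprS. Qed.

Lemma orth_rep_order g : (1 < p)%N -> rho g ^+ p = 1%:M.
Proof.
move=> p1; rewrite -orth_repX (_ : g *+ p = 0) ?orth_rep0 //.
by apply/rowP => i; rewrite mulmxnE mxE -mulr_natr pchar_Zp // mulr0.
Qed.

End OrthRep.

(** The exponents are the representatives of the entries of [g] as natural numbers;
    [A ^+ p = B ^+ p = 1] makes the wrap-around modulo [p] harmless. *)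
Definition two_gen p n (A B : 'M[R]_n) (g : 'rV['Z_p]_2) : 'M[R]_n :=
  A ^+ (g ord0 ord0 : nat) *m B ^+ (g ord0 ord_max : nat).

Lemma mulmx_trX n (A : 'M[R]_n) k : A *m A^T = 1%:M -> A ^+ k *m (A ^+ k)^T = 1%:M.
Proof.
move=> oA; elim: k => [|k IH]; first by rewrite expr0 trmx1 mulmx1.
by rewrite exprS trmx_mul -[A * _]/(A *m _) mulmxA -(mulmxA A) IH mulmx1.
Qed.

Lemma two_gen_rep p n (A B : 'M[R]_n) :
  (1 < p)%N -> A *m A^T = 1%:M -> B *m B^T = 1%:M -> A *m B = B *m A ->
  A ^+ p = 1%:M -> B ^+ p = 1%:M -> orth_rep (two_gen (p := p) A B).
Proof.
move=> p1 oA oB AB Ap Bp; split=> [g h|g]; last first.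
  by rewrite /two_gen trmx_mul mulmxA -(mulmxA (A ^+ _)) 
    mulmx_trX // mulmx1 mulmx_trX.
have E (C : 'M[R]_n) (x y : 'Z_p) : C ^+ p = 1%:M ->
    C ^+ ((x + y)%R : nat) = C ^+ (x : nat) *m C ^+ (y : nat).
  move=> Cp; rewrite -[RHS]exprD /=.
  move: x y; rewrite Zp_cast // => x y.
  exact: expr_mod.
rewrite /two_gen !mxE !E // -!mulmxA; congr (_ *m _); rewrite !mulmxA; congr (_ *m _).
by apply: commrX; apply: commr_sym; apply: commrX.
Qed.

Lemma two_gen_sub_p_toral p (X : 'rV[R]_3 -> Prop) (A B : 'M[R]_3) (x0 : 'rV[R]_3) :
  (1 < p)%N -> A *m A^T = 1%:M -> B *m B^T = 1%:M -> A *m B = B *m A ->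
  A ^+ p = 1%:M -> B ^+ p = 1%:M ->
  (forall x, X x -> exists i j : nat, x = x0 *m (A ^+ i *m B ^+ j)) ->
  sub_p_toral p X.
Proof.
move=> p1 oA oB AB Ap Bp Xx; have [rM rO] := two_gen_rep p1 oA oB AB Ap Bp.
exists 0%N, 2%N; split=> //; exists (two_gen (p := p) A B); split=> //; split=> //.
exists x0 => x /Xx[i [j ->]].
exists (\row_k if k == ord0 then i%:R else j%:R).
rewrite /two_gen !mxE /= !val_Zp_nat // !expr_mod //.
(* Here [m = 0], so the inclusion appends an empty block. *)
apply/rowP => k; rewrite (_ : k = lshift 0 k) ?row_mxEl; last exact: val_inj.
by congr (_ _ _); apply: val_inj.
Qed.
End Rep.

(** * Gram triples of orbits *)

Section Cone.
Context {R : realType}.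

(** The Gram data of an orbit point and its translates by the two standard generators of a rank-two
    torus. Leaving the common squared norm [w] free turns these data into a convex cone, whose slice
    [w = 1] is the convex set of interest. *)
Definition toral_gram p (w x y z : R) : Prop :=
  exists n (rho : 'rV['Z_p]_2 -> 'M[R]_n) (v : 'rV[R]_n),
    let b := v *m rho (delta_mx ord0 ord0) in
    let c := v *m rho (delta_mx ord0 ord_max) in
    orth_rep rho /\ [/\ dot v v = w, dot v b = x, dot v c = y & dot b c = z].

(** Gram matrices add under direct sums of representations. *)
Lemma toral_gramD p w x y z w' x' y' z' :
  toral_gram p w x y z -> toral_gram p w' x' y' z' ->
  toral_gram p (w + w') (x + x') (y + y') (z + z').
Proof.
move=> [n [r [v [[rD rO] [<- <- <- <-]]]]] [n' [r' [v' [[rD' rO'] [<- <- <- <-]]]]].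
exists (n + n')%N, (fun g => block_mx (r g) 0 0 (r' g)), (row_mx v v').
rewrite !mul_row_block !mulmx0 !addr0 !add0r; split; last by rewrite !dot_row_mx; split.
split=> [g h|g].
  by rewrite mulmx_block !mul0mx !mulmx0 !addr0 !add0r rD rD'.
rewrite tr_block_mx mulmx_block !trmx0 !mul0mx !mulmx0 !addr0 !add0r rO rO'.
by rewrite -scalar_mx_block.
Qed.

Lemma toral_gramZ p k w x y z : 0 <= k ->
  toral_gram p w x y z -> toral_gram p (k * w) (k * x) (k * y) (k * z).
Proof.
move=> k0 [n [r [v [rr [<- <- <- <-]]]]]; exists n, r, (Num.sqrt k *: v).
split; first exact: rr.
rewrite -!scalemxAl !dotZl !dotZr !mulrA -expr2 sqr_sqrtr //.
Qed.

Lemma toral_gram_cos p (s t : R) : (1 < p)%N ->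
  rotz s ^+ p = 1%:M -> rotz t ^+ p = 1%:M ->
  toral_gram p 1 (cos s) (cos t) (cos (s - t)).
Proof.
move=> p1 sp tp; exists 3%N, (two_gen (p := p) (rotz s) (rotz t)), (delta_mx ord0 ord0).
split; first by apply: two_gen_rep; rewrite ?rotz_orth // -!rotzD addrC.
have E (i j : 'I_2) : ((delta_mx ord0 i : 'rV['Z_p]_2) ord0 j : nat) = (i == j).
  rewrite mxE eqxx /= eq_sym.
  by case: p p1 {sp tp} => [|[|q]] // _; case: (i == j).
have d0 (r : R) : dot (delta_mx ord0 ord0) (delta_mx ord0 ord0 *m rotz r) = cos r.
  by have := dot_delta_rotz 0 r; rewrite rotz0 mulmx1 sub0r cosN.
rewrite /two_gen !E /= mulmx1 mul1mx !expr1 !d0 dot_delta_rotz; split=> //.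
by have := d0 0; rewrite rotz0 mulmx1 cos0.
Qed.

(** The sign condition puts [x] strictly between [x1] and [x2] without fixing their order. Squared
    denominators in the proof avoid a case split on the sign of [x1 - x2]. *)
Lemma between_convex (x x1 x2 : R) : (x - x1) * (x - x2) < 0 ->
  exists t, [/\ 0 <= t, t <= 1 & x = t * x1 + (1 - t) * x2].
Proof.
move=> h; exists ((x - x2) / (x1 - x2)).
have d : x1 - x2 != 0.
  apply: contraTneq h => /eqP; rewrite subr_eq0 => /eqP->.
  by rewrite -leNgt -expr2 sqr_ge0.
have E : (x - x2) / (x1 - x2) = ((x - x2) * (x1 - x2)) / (x1 - x2) ^+ 2 by field.
have E' : 1 - (x - x2) / (x1 - x2) = ((x1 - x) * (x1 - x2)) / (x1 - x2) ^+ 2 by field.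
split; last by field.
  by rewrite E divr_ge0 ?sqr_ge0 //; have := sqr_ge0 (x - x2); nra.
by rewrite -subr_ge0 E' divr_ge0 ?sqr_ge0 //; have := sqr_ge0 (x - x1); nra.
Qed.

Lemma toral_gram_convex p (t x y z x' y' z' : R) : 0 <= t -> t <= 1 ->
  toral_gram p 1 x y z -> toral_gram p 1 x' y' z' ->
  toral_gram p 1 (t * x + (1 - t) * x') (t * y + (1 - t) * y') (t * z + (1 - t) * z').
Proof.
move=> t0; rewrite -subr_ge0 => t1 /(toral_gramZ t0) h /(toral_gramZ t1) h'.
by have := toral_gramD h h'; rewrite !mulr1 [t + _]addrC subrK.
Qed.

(* The two values of [z] compatible with [x = cos s] and [y = cos t] are
   [cos (s - t)] and [cos (s + t)]; every [z] strictly between them satisfies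
   the Gram determinant inequality. *)
Lemma toral_gram_det p (s t z : R) : (1 < p)%N ->
  rotz s ^+ p = 1%:M -> rotz t ^+ p = 1%:M ->
  0 < 1 + 2 * cos s * cos t * z - cos s ^+ 2 - cos t ^+ 2 - z ^+ 2 ->
  toral_gram p 1 (cos s) (cos t) z.
Proof.
move=> p1 sp tp D.
have [|k [k0 k1 ->]] := @between_convex z (cos (s - t)) (cos (s + t)).
  rewrite cosB cosD.
  (* This product is minus the Gram determinant once the squared sines are expressed by cosines. *)
  have -> : (z - (cos s * cos t + sin s * sin t)) *
      (z - (cos s * cos t - sin s * sin t))
     = (z - cos s * cos t) ^+ 2 - sin s ^+ 2 * sin t ^+ 2 by ring.
  by rewrite !sin2cos2; lra.
have h1 := toral_gram_cos p1 sp tp.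
have := toral_gram_cos p1 sp (rotzNX tp); rewrite opprK cosN => h2.
by have := toral_gram_convex k0 k1 h1 h2; rewrite -!mulrDl [k + _]addrC subrK !mul1r.
Qed.

(** Cosine decreases on the interval from 0 to pi, so the target is an open interval of angles from
    [acos v] to [acos u]. A grid of step 2 pi / p meets it as soon as the step is shorter than its
    length. *)
Lemma grid_cos (u v : R) : -1 <= u -> u < v -> v <= 1 ->
  exists N : nat, forall p, (N <= p)%N ->
    exists j : nat, u < cos (2 * pi * j%:R / p%:R) < v.
Proof.
move=> u1 uv v1.
have hu : -1 <= u <= 1 by lra.
have hv : -1 <= v <= 1 by lra.
set s := acos v; set t := acos u.
have cs : cos s = v by apply: acosK; rewrite in_itv.
have ct : cos t = u by apply: acosK; rewrite in_itv.
have s0 : 0 <= s by apply: acos_ge0.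
have t0 : 0 <= t by apply: acos_ge0.
have spi : s <= pi by apply: acos_lepi.
have tpi : t <= pi by apply: acos_lepi.
have st : s < t.
  by rewrite -ltr_cos ?in_itv /= ?s0 ?t0 // cs ct.
have pi0 := pi_gt0 R.
exists (Num.truncn (2 * pi / (t - s))).+1 => p Np.
have p_gt : 2 * pi / (t - s) < p%:R.
  by apply: lt_le_trans (truncnS_gt _) _; rewrite ler_nat.
have p0 : 0 < p%:R :> R.
  by apply: le_lt_trans p_gt; rewrite divr_ge0 // ?subr_ge0 ?mulr_ge0 // ltW.
set q := s * p%:R / (2 * pi).
have q0 : 0 <= q by rewrite divr_ge0 ?mulr_ge0 // ltW.
have /andP[j1 j2] := truncn_itv q0.
(* The first grid angle strictly beyond [s]; it exceeds [s] by at most one step, hence stays below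
   [t]. *)
exists (Num.truncn q).+1; set r := _ / p%:R.
have sr : s < r.
  move: j2; rewrite /q ltr_pdivrMr; last by lra.
  by move=> h; rewrite /r ltr_pdivlMr // (lt_le_trans h) // mulrC.
have rt : r < t.
  have E : q * (2 * pi) = s * p%:R by rewrite divfK // gt_eqF //; lra.
  move: p_gt; rewrite ltr_pdivrMr ?subr_gt0 // => p_gt.
  rewrite /r ltr_pdivrMr // -natr1; nra.
by rewrite -ct -cs !ltr_cos ?in_itv /=; lra.
Qed.


(** The change of the determinant splits into four terms, two from the squares and two from the
    triple product, each of size at most [2 * e]. *)
Lemma gram_det_nbhs (x y z x' y' e : R) :
  -1 <= x <= 1 -> -1 <= y' <= 1 -> -1 <= z <= 1 -> -1 <= x' <= 1 -> -1 <= y <= 1 ->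
  x - e <= x' <= x + e -> y - e <= y' <= y + e ->
  8 * e < 1 + 2 * x * y * z - x ^+ 2 - y ^+ 2 - z ^+ 2 ->
  0 < 1 + 2 * x' * y' * z - x' ^+ 2 - y' ^+ 2 - z ^+ 2.
Proof.
move=> hx hy' hz hx' hy xx yy h.
have e0 : 0 <= e by lra.
have nM (r s : R) : -e <= s <= e -> -2 <= r <= 2 -> - (2 * e) <= r * s <= 2 * e.
  by move=> hs hr; apply/andP; split; nra.
have nZ (r : R) : -2 <= r <= 2 -> -2 <= z * r <= 2.
  by move=> hr; apply/andP; split; nra.
have h1 : - (2 * e) <= (x' + x) * (x' - x) <= 2 * e by apply: nM; lra.
have h2 : - (2 * e) <= (y' + y) * (y' - y) <= 2 * e by apply: nM; lra.
have h3 : - (2 * e) <= (z * (2 * y')) * (x' - x) <= 2 * e.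
  by apply: nM; [lra|apply: nZ; lra].
have h4 : - (2 * e) <= (z * (2 * x)) * (y' - y) <= 2 * e.
  by apply: nM; [lra|apply: nZ; lra].
lra.
Qed.

Lemma toral_gram_large (x y z : R) :
  -1 < x < 1 -> -1 < y < 1 -> -1 <= z <= 1 ->
  0 < 1 + 2 * x * y * z - x ^+ 2 - y ^+ 2 - z ^+ 2 ->
  exists N : nat, forall p, (1 < p)%N -> (N <= p)%N -> toral_gram p 1 x y z.
Proof.
move=> hx hy hz D.
set d := _ - z ^+ 2 in D.
(* The bound [d / 16] gives [8 * e < d]; the other bounds keep the [e]-neighbourhoods of [x] and [y]
   inside the range of cosine. *)
pose e := Num.min (d / 16)
  (Num.min (Num.min (x + 1) (1 - x)) (Num.min (y + 1) (1 - y))).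
have e0 : 0 < e.
  by rewrite !lt_min; apply/and3P; split; [|apply/andP; split|apply/andP; split]; lra.
have : e <= e by [].
rewrite {2}/e !le_min => /andP[e1 /andP[/andP[e2 e3] /andP[e4 e5]]].
(* For large [p], grid cosines lie within [e] of [x] and of [y], on both sides of each. *)
have [||| N1 h1] := @grid_cos (x - e) x; [lra..|].
have [||| N2 h2] := @grid_cos x (x + e); [lra..|].
have [||| N3 h3] := @grid_cos (y - e) y; [lra..|].
have [||| N4 h4] := @grid_cos y (y + e); [lra..|].
exists (maxn (maxn N1 N2) (maxn N3 N4)) => p p1.
rewrite !geq_max => /andP[/andP[/h1[i1 i1P] /h2[i2 i2P]] /andP[/h3[j1 j1P] /h4[j2 j2P]]].
have p0 : (0 < p)%N by exact: ltnW.
have G (i j : nat) : let X := cos (2 * pi * i%:R / p%:R) : R in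
    let Y := cos (2 * pi * j%:R / p%:R) : R in
    x - e <= X <= x + e -> y - e <= Y <= y + e -> toral_gram p 1 X Y z.
  move=> X Y hX hY; apply: toral_gram_det => //; try exact: rotz_order.
  by apply: (@gram_det_nbhs x y z _ _ e); rewrite -/d -/X -/Y; lra.
(* Interpolate in [x] with a grid value [Y] held fixed; interpolation in [y] follows. *)
have Gx (j : nat) : let Y := cos (2 * pi * j%:R / p%:R) : R in
    y - e <= Y <= y + e -> toral_gram p 1 x Y z.
  move=> Y hY.
  have [|k [k0 k1 ->]] := @between_convex x
    (cos (2 * pi * i1%:R / p%:R)) (cos (2 * pi * i2%:R / p%:R)); first by nra.
  have := toral_gram_convex k0 k1 (G i1 j _ hY) (G i2 j _ hY).
  by rewrite -!mulrDl [k + _]addrC subrK !mul1r; apply; lra.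
have [|k [k0 k1 ->]] := @between_convex y
  (cos (2 * pi * j1%:R / p%:R)) (cos (2 * pi * j2%:R / p%:R)); first by nra.
have := toral_gram_convex k0 k1 (Gx j1 _) (Gx j2 _).
by rewrite -!mulrDl [k + _]addrC subrK !mul1r; apply; lra.
Qed.

(* Rotate [R^(3 + n)] so that the orbit representative and its two translates
   fall on the given vectors of [R^3]. *)
Lemma toral_gram_sub_p_toral p (a b c : 'rV[R]_3) :
  dot b b = dot a a -> dot c c = dot a a ->
  toral_gram p (dot a a) (dot a b) (dot a c) (dot b c) ->
  sub_p_toral p (fun x => x = a \/ x = b \/ x = c).
Proof.
move=> bb cc [n [r [v [[rD rO] [vv vb vc bc]]]]].
set g := delta_mx ord0 ord0 in vb bc; set h := delta_mx ord0 ord_max in vc bc.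
pose us := [:: v; v *m r g; v *m r h].
pose vs := [:: a; b; c].
have [|Q oQ Qu] := @orthogonal_extension R (3 + n) 3
  (fun i => row_mx 0 (nth 0 us i)) (fun i => row_mx (nth 0 vs i) 0).
  have iso k u w := dot_mul_orth u w (rO k).
  have gram := (vv, vb, vc, bc, bb, cc).
  move=> [|[|[|//]]] [|[|[|//]]] _ _ /=; rewrite !dot_row_mx !dot0l addr0 add0r;
    by rewrite ?iso ?gram // dotC ?iso ?gram // dotC.
(* The sum of the trivial representation on the first three coordinates and [r], conjugated by
   [Q]. *)
pose r' k : 'M[R]_(3 + n) := Q^T *m block_mx 1%:M 0 0 (r k) *m Q.
have oQ' := mulmx1C oQ.
have M k : row_mx a 0 *m r' k = row_mx 0 (v *m r k) *m Q.
  rewrite -(Qu 0%N) //= /r' !mulmxA -(mulmxA _ Q) oQ mulmx1 mul_row_block.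
  by rewrite !mul0mx !mulmx0 !add0r.
exists n, 2%N; split=> //; exists r'; split=> [k l|].
  rewrite /r' rD !mulmxA -(mulmxA _ Q) oQ mulmx1; congr (_ *m _).
  rewrite -!mulmxA; congr (_ *m _).
  by rewrite mulmx_block !mul0mx !mulmx0 !addr0 !add0r mul1mx.
split=> [k|].
  rewrite /r' !trmx_mul trmxK !mulmxA -(mulmxA _ Q) oQ mulmx1.
  rewrite -(mulmxA _ (block_mx _ _ _ _)) tr_block_mx mulmx_block !trmx0 !mul0mx !mulmx0.
  by rewrite !addr0 !add0r rO trmx1 mulmx1 -scalar_mx_block mulmx1.
exists (row_mx a 0) => x [->|[->|->]].
- exists 0; rewrite M (orth_rep0 (conj rD rO)) mulmx1; exact/esym/(Qu 0%N).
- by exists g; rewrite M; exact/esym/(Qu 1%N).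
- by exists h; rewrite M; exact/esym/(Qu 2%N).
Qed.

(** A vanishing Gram determinant yields a linear relation between the vectors. If its coefficients
    have nonzero sum, normalising them puts the origin in the affine span; a zero sum would force
    two points to coincide or [a], [b] to be antipodal. *)
Lemma gram_det_gt0 k (a b c : 'rV[R]_k) (x := dot a b) (y := dot a c) (z := dot b c) :
  a != b -> a != c -> b != c ->
  dot a a = 1 -> dot b b = 1 -> dot c c = 1 ->
  ~ (exists l1 l2 l3 : R, l1 + l2 + l3 = 1 /\ l1 *: a + l2 *: b + l3 *: c = 0) ->
  -1 < x < 1 /\ 0 < 1 + 2 * x * y * z - x ^+ 2 - y ^+ 2 - z ^+ 2.
Proof.
move=> ab ac bc aa bb cc H.
have x1 : x != 1 by apply: contraNneq ab => /(unit_eq aa bb) ->.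
have y1 : y != 1 by apply: contraNneq ac => /(unit_eq aa cc) ->.
have z1 : z != 1 by apply: contraNneq bc => /(unit_eq bb cc) ->.
have xN1 : x != -1.
  apply/eqP => /(unit_antipodal aa bb) bE; apply: H; exists 2^-1, 2^-1, 0.
  split; first by field.
  by rewrite bE scalerN subrr scale0r addr0.
have x21 : 0 < 1 - x ^+ 2.
  have := dot_ge0 (b - x *: a).
  rewrite !dot_lin aa bb (dotC b a) -/x => h.
  rewrite lt_neqAle; apply/andP; split; last by lra.
  rewrite -[X in X - _](expr1n _ 2) subr_sqr eq_sym mulf_neq0 //.
    by rewrite subr_eq0 eq_sym.
  by rewrite addrC addr_eq0.
split; first by apply/andP; split; nra.
set D := _ - z ^+ 2.
(* This is [1 - x ^+ 2] times the component of [c] orthogonal to [a] and [b]. *)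
pose w := (1 - x ^+ 2) *: c - (y - x * z) *: a - (z - x * y) *: b.
have ww : dot w w = (1 - x ^+ 2) * D.
  rewrite /w !dot_lin (dotC b a) (dotC c a) (dotC c b) aa bb cc -/x -/y -/z /D; ring.
have D0 : 0 <= D by rewrite -(pmulr_rge0 _ x21) -ww dot_ge0.
rewrite lt_neqAle D0 andbT eq_sym; apply/eqP => DE.
have w0 : w = 0 by apply: dot_eq0; rewrite ww DE mulr0.
(* The sum of the coefficients of [w], factored. *)
pose s := (1 - x) * (1 + x - y - z).
have [s0|s0] := eqVneq s 0.
  have : 1 + x - y - z = 0.
    by apply/eqP; move/eqP: s0; rewrite mulf_eq0 subr_eq0 eq_sym (negPf x1).
  move=> xE; have xE' : x = y + z - 1 by lra.
  (* On [x = y + z - 1] the determinant is twice this product. *)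
  have : (1 + x) * ((1 - y) * (1 - z)) = 0 by move: DE; rewrite /D xE' => DE; lra.
  move/eqP; rewrite !mulf_eq0 addrC addr_eq0 (negPf xN1) !subr_eq0.
  by rewrite eq_sym (negPf y1) eq_sym (negPf z1).
apply: H; exists (- (y - x * z) / s), (- (z - x * y) / s), ((1 - x ^+ 2) / s).
split; first by rewrite -!mulrDl [X in X / _](_ : _ = s) ?divff // /s; ring.
rewrite -[RHS](scaler0 _ s^-1) -w0 /w; apply/rowP => j; rewrite !mxE; ring.
Qed.

Lemma sub_p_toral_large (a b c : 'rV[R]_3) :
  a != b -> a != c -> b != c ->
  dot a a = 1 -> dot b b = 1 -> dot c c = 1 ->
  ~ (exists l1 l2 l3 : R, l1 + l2 + l3 = 1 /\ l1 *: a + l2 *: b + l3 *: c = 0) ->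
  exists N : nat, forall p, prime p -> (N <= p)%N ->
    sub_p_toral p (fun x => x = a \/ x = b \/ x = c).
Proof.
move=> ab ac bc aa bb cc H.
have [hx D] := gram_det_gt0 ab ac bc aa bb cc H.
(* Exchanging [b] and [c] gives the strict bounds on [dot a c]. *)
have H' : ~ exists l1 l2 l3 : R, l1 + l2 + l3 = 1 /\ l1 *: a + l2 *: c + l3 *: b = 0.
  move=> [l1 [l2 [l3 [s e]]]]; apply: H; exists l1, l3, l2.
  by rewrite addrAC s addrAC e.
have cb : c != b by rewrite eq_sym.
have [hy _] := gram_det_gt0 ac ab cb aa cc bb H'.
have hz : -1 <= dot b c <= 1.
  have := dot_ge0 (b - c); have := dot_ge0 (b + c).
  by rewrite !dot_lin (dotC c b) bb cc; lra.
have [N hN] := toral_gram_large hx hy hz D.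
exists N => p /prime_gt1 p1 /(hN _ p1) h.
by apply: toral_gram_sub_p_toral; rewrite ?aa ?bb ?cc.
Qed.

End Cone.

(** * Roots of unity in an orbit *)

Section Eigen.

(** Peel off one linear factor at a time: either [v] is already an eigenvector, or its nonzero image
    under [M - z] is killed by the remaining factors, and still by [N] because [M] and [N]
    commute. *)
Lemma common_eigenvector (F : fieldType) n (M N : 'M[F]_n.+1) (s : seq F)
    (v : 'rV[F]_n.+1) :
  M *m N = N *m M -> v != 0 -> v *m N = 0 ->
  v *m horner_mx M (\prod_(z <- s) ('X - z%:P)) = 0 ->
  exists z (u : 'rV_n.+1), [/\ u != 0, u *m M = z *: u & u *m N = 0].
Proof.
move=> MN; elim: s v => [|z s IH] v v0 vN.
  by rewrite big_nil rmorph1 mulmx1 => /eqP; rewrite (negPf v0).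
rewrite big_cons rmorphM rmorphB /= horner_mx_X horner_mx_C mulmxA.
have [vM _|vM] := eqVneq (v *m (M - z%:M)) 0; last first.
  apply: IH => //.
  by rewrite -mulmxA mulmxBl MN -scalar_mxC -mulmxBr mulmxA vN mul0mx.
exists z, v; split=> //; apply/eqP.
by rewrite -subr_eq0 -mul_mx_scalar -mulmxBr vM.
Qed.

Context {R : realType}.
Local Open Scope complex_scope.

Definition cis (t : R) : R[i] := cos t +i* sin t.

Lemma cisX t k : cis t ^+ k = cis (t * k%:R).
Proof.
elim: k => [|k IH]; first by rewrite mulr0 /cis cos0 sin0.
rewrite exprS IH -natr1 mulrDr mulr1 addrC /cis cosD sinD.
by apply/eqP; rewrite eq_complex /=; apply/andP; split; apply/eqP; ring.
Qed.

(** The order divides the prime [p]. Order 1 would give the angle cosine 1, hence angle 0, cosine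
    being injective up to pi. *)
Lemma cis_prim_root p : prime p -> p.-primitive_root (cis (2 * pi / p%:R)).
Proof.
move=> pp; have p0 := prime_gt0 pp.
have p0' : 0 < p%:R :> R by rewrite ltr0n.
have pi0 := pi_gt0 R.
have zp : cis (2 * pi / p%:R) ^+ p = 1.
  rewrite cisX divfK ?gt_eqF // -[2 * pi]mulr1 /cis.
  by rewrite (cos_2pi_nat 1) (sin_2pi_nat 1).
have [m zm mp] := prim_order_exists p0 zp.
have /predU1P[m1|/eqP mE] := (primeP pp).2 m mp;
  last by rewrite -{1}mE.
have := prim_expr_order zm; rewrite m1 expr1 => -[c1 _].
have : 2 * pi / p%:R = 0 :> R.
  apply: cos_inj; rewrite ?in_itv /= ?cos0 //; last by rewrite lexx ltW.
  rewrite divr_ge0 ?mulr_ge0 ?(ltW pi0) //= ler_pdivrMr // mulrC ler_pM2l //.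
  by rewrite ler_nat prime_gt1.
by move/eqP; rewrite mulf_eq0 invr_eq0 !gt_eqF //; lra.
Qed.

Lemma unity_root_cis p (w : R[i]) : prime p -> w ^+ p = 1 ->
  exists j : nat, w = cis (2 * pi * j%:R / p%:R).
Proof.
move=> pp /(prim_rootP (cis_prim_root pp))[j ->].
by exists j; rewrite cisX mulrAC.
Qed.

(* If [c = l a + m b] lies in the orbit of [a], the vector [a] is killed by
   [rho h - l - m rho g]; a common complex eigenvector in that kernel turns the
   relation into one between roots of unity. *)
Lemma orbit_relation n p (M K : 'M[R]_n.+1) (a : 'rV[R]_n.+1) (l m : R) :
  prime p -> M *m K = K *m M -> M ^+ p = 1 -> K ^+ p = 1 -> a != 0 ->
  a *m K = l *: a + m *: (a *m M) ->
  exists w : R[i], w ^+ p = 1 /\ (l%:C + m%:C * w) ^+ p = 1.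
Proof.
move=> pp MK Mp Kp a0 rel.
pose f := real_complex R.
pose N := K - l%:M - m *: M.
have MN : M *m N = N *m M.
  by rewrite /N !mulmxBr !mulmxBl MK scalar_mxC -scalemxAr -scalemxAl.
have aN : a *m N = 0.
  by rewrite /N !mulmxBr rel mul_mx_scalar -scalemxAr addrAC addrK subrr.
have ex (A : 'M[R]_n.+1) : map_mx f A ^+ p = map_mx f (A ^+ p) by rewrite rmorphXn.
have [||||w [u [u0 uM uN]]] := @common_eigenvector _ n (map_mx f M) (map_mx f N)
    [seq cis (2 * pi / p%:R) ^+ i | i <- index_iota 0 p] (map_mx f a).
- by rewrite -!map_mxM MN.
- by rewrite map_mx_eq0.
- by rewrite -map_mxM aN map_mx0.
(* The product over all [p]-th roots of unity is X^p - 1, which annihilates [M]. *)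
- rewrite big_map factor_Xn_sub_1 ?cis_prim_root //.
  by rewrite rmorphB rmorphXn /= horner_mx_X ex Mp !rmorph1 subrr mulmx0.
have eigX (A : 'M[R[i]]_n.+1) (z : R[i]) k :
    u *m A = z *: u -> u *m A ^+ k = z ^+ k *: u.
  move=> uA; elim: k => [|k IH]; first by rewrite !expr0 scale1r mulmx1.
  by rewrite exprSr [A ^+ k * A]/(_ *m _) mulmxA IH -scalemxAl uA scalerA exprSr.
have eig1 (A : 'M[R[i]]_n.+1) (z : R[i]) : A ^+ p = 1 -> u *m A = z *: u -> z ^+ p = 1.
  move=> Ap /(eigX _ _ p); rewrite Ap mulmx1 => /esym/eqP.
  rewrite -{2}[u]scale1r -subr_eq0 -scalerBl scaler_eq0 (negPf u0) orbF subr_eq0.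
  by move/eqP.
exists w; split; first by apply: eig1 uM; rewrite ex Mp rmorph1.
apply: (eig1 (map_mx f K)); first by rewrite ex Kp rmorph1.
(* That [N] kills [u] means that [u] is an eigenvector of [K] for l + m w. *)
move: uN; rewrite /N !map_mxB map_mxZ map_scalar_mx !mulmxBr
  mul_mx_scalar -scalemxAr uM.
by move/eqP; rewrite -addrA -opprD subr_eq0 => /eqP ->; rewrite scalerDl scalerA.
Qed.

End Eigen.

(** * Triples on the great circle *)

Section Circle.
Context {R : realType}.

Lemma dot3E (u v : 'rV[R]_3) :
  dot u v = u ord0 ord0 * v ord0 ord0 +
            u ord0 (lift ord0 ord0) * v ord0 (lift ord0 ord0) + u ord0 i3 * v ord0 i3.
Proof.
rewrite /dot !big_ord_recl big_ord0 addr0 addrA.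
by rewrite (_ : lift ord0 (lift ord0 ord0) = i3) //; apply: val_inj.
Qed.

Lemma rowP3 (u v : 'rV[R]_3) :
  u ord0 ord0 = v ord0 ord0 -> u ord0 (lift ord0 ord0) = v ord0 (lift ord0 ord0) ->
  u ord0 i3 = v ord0 i3 -> u = v.
Proof.
move=> h0 h1 h2; apply/rowP => -[[|[|[|//]]] hj].
- by rewrite (_ : Ordinal hj = ord0) //; apply: val_inj.
- by rewrite (_ : Ordinal hj = lift ord0 ord0) //; apply: val_inj.
- by rewrite (_ : Ordinal hj = i3) //; apply: val_inj.
Qed.

(** Three vectors in a plane have zero Gram determinant; under the right-angle relation
    [z = x + y - 1] it is twice (z + 1)(1 - x)(1 - y), and only the first factor can vanish. *)
Lemma thales (a b c : 'rV[R]_3) :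
  a ord0 i3 = 0 -> b ord0 i3 = 0 -> c ord0 i3 = 0 ->
  dot a a = 1 -> dot b b = 1 -> dot c c = 1 ->
  a != b -> a != c -> dot (b - a) (c - a) = 0 -> c = - b.
Proof.
move=> a3 b3 c3 aa bb cc ab ac.
rewrite !dot_lin aa (dotC b a) => h.
have x1 : dot a b != 1 by apply: contraNneq ab => /(unit_eq aa bb) ->.
have y1 : dot a c != 1 by apply: contraNneq ac => /(unit_eq aa cc) ->.
apply: unit_antipodal => //.
have G : dot a a * dot b b * dot c c + 2 * dot a b * dot a c * dot b c
    - dot a a * dot b c ^+ 2 - dot b b * dot a c ^+ 2 - dot c c * dot a b ^+ 2 = 0.
  by rewrite !dot3E a3 b3 c3; ring.
move: G h x1 y1; rewrite aa bb cc.
move: (dot a b) (dot a c) (dot b c) => x y z G h x1 y1.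
have zE : z = x + y - 1 by lra.
have : (z + 1) * ((1 - x) * (1 - y)) = 0 by move: G; rewrite zE => G; lra.
move/eqP; rewrite !mulf_eq0 !subr_eq0 ![1 == _]eq_sym (negPf x1) (negPf y1) !orbF.
by rewrite addr_eq0 => /eqP.
Qed.

Lemma antipodal_right_triangle (a b c : 'rV[R]_3) :
  dot a a = 1 -> dot b b = 1 -> dot c c = 1 ->
  b = - a \/ c = - a \/ c = - b -> right_triangle a b c.
Proof.
move=> aa bb cc [->|[->|->]]; [right; right|right; left|left];
  rewrite !dot_lin ?aa ?bb ?cc; [rewrite (dotC c a)|rewrite (dotC b a)..]; ring.
Qed.

(** The reflection exchanging [u] and [w] commutes with -1; together they generate the orbit of [u],
    [-u], [w], [-w]. *)
Lemma antipodal_sub_2_toral (u w : 'rV[R]_3) (X : 'rV[R]_3 -> Prop) :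
  dot u u = dot w w -> (forall x, X x -> [\/ x = u, x = - u | x = w]) ->
  sub_p_toral 2 X.
Proof.
move=> uw Xx.
apply: (@two_gen_sub_p_toral _ 2 X (- 1%:M) (reflection (u - w)) u) => //.
- by rewrite linearN /= trmx1 mulNmx mulmxN opprK mulmx1.
- by rewrite reflection_tr reflectionK.
- by rewrite mulNmx mulmxN mul1mx mulmx1.
- by rewrite sqrrN expr1n.
- exact: reflectionK.
move=> x /Xx[->|->|->].
- by exists 0%N, 0%N; rewrite !expr0 !mulmx1.
- by exists 1%N, 0%N; rewrite expr0 expr1 mulmx1 mulmxN mulmx1.
- by exists 0%N, 1%N; rewrite expr0 expr1 mul1mx reflection_swap.
Qed.

Lemma right_triangle_sub_2_toral (a b c : 'rV[R]_3) :
  a ord0 i3 = 0 -> b ord0 i3 = 0 -> c ord0 i3 = 0 ->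
  dot a a = 1 -> dot b b = 1 -> dot c c = 1 ->
  a != b -> a != c -> b != c -> right_triangle a b c ->
  sub_p_toral 2 (fun x => x = a \/ x = b \/ x = c).
Proof.
move=> a3 b3 c3 aa bb cc ab ac bc.
have ba : b != a by rewrite eq_sym.
have ca : c != a by rewrite eq_sym.
have cb : c != b by rewrite eq_sym.
case=> [|[]] /thales h.
- apply: (@antipodal_sub_2_toral b a); rewrite ?aa ?bb // => x.
  by rewrite h // => -[|[|]] ->; [constructor 3|constructor 1|constructor 2].
- apply: (@antipodal_sub_2_toral a b); rewrite ?aa ?bb // => x.
  by rewrite [c]h // => -[|[|]] ->; [constructor 1|constructor 3|constructor 2].
- apply: (@antipodal_sub_2_toral a c); rewrite ?aa ?cc // => x.
  by rewrite [b]h // => -[|[|]] ->; [constructor 1|constructor 2|constructor 3].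
Qed.

Lemma rotz_orbit_sub_p_toral p (X : 'rV[R]_3 -> Prop) (x0 : 'rV[R]_3) : (1 < p)%N ->
  (forall x, X x -> exists j : nat, x = x0 *m rotz (2 * pi * j%:R / p%:R)) ->
  sub_p_toral p X.
Proof.
move=> p1 Xx.
apply: (@two_gen_sub_p_toral _ p X (rotz (2 * pi * 1%:R / p%:R)) 1%:M x0) => //.
- exact: rotz_orth.
- by rewrite trmx1 mulmx1.
- by rewrite mulmx1 mul1mx.
- by apply: rotz_order; exact: ltnW.
- exact: expr1n.
move=> x /Xx[j ->]; exists j, 0%N.
by rewrite expr0 mulmx1 rotzX mulr1 mulrAC.
Qed.

(** Rotation indices are natural numbers, so -j is represented by (p - 1) j modulo [p]. *)
Lemma rotz_opp p j : (0 < p)%N ->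
  rotz (- (2 * pi * j%:R / p%:R)) = rotz (2 * pi * (p.-1 * j)%:R / p%:R) :> 'M[R]_3.
Proof.
case: p => // p _ /=.
have -> : 2 * pi * (p * j)%:R / p.+1%:R =
    2 * pi * j%:R + - (2 * pi * j%:R / p.+1%:R) :> R.
  by rewrite natrM -natr1; field; rewrite nat1r pnatr_eq0.
by rewrite rotzD rotz_2pi_nat mul1mx.
Qed.

(** Differences of group elements move the base point of the orbit to [a]. *)
Lemma sub_p_toral_translates p k (a b c : 'rV[R]_k) :
  prime p -> sub_p_toral p (fun x => x = a \/ x = b \/ x = c) ->
  exists m (M K : 'M[R]_(k + m)),
    [/\ M *m K = K *m M, M ^+ p = 1%:M, K ^+ p = 1%:M,
        row_mx b 0 = row_mx a 0 *m M & row_mx c 0 = row_mx a 0 *m K].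
Proof.
move=> /prime_gt1 p1 [m [al [_ [rho [rD [rO [x0 H]]]]]]].
have rr := conj rD rO : orth_rep rho.
have [ga Ha] := H a (or_introl erefl).
have [gb Hb] := H b (or_intror (or_introl erefl)).
have [gc Hc] := H c (or_intror (or_intror erefl)).
exists m, (rho (gb - ga)), (rho (gc - ga)); split.
- by rewrite -!rD addrC.
- exact: orth_rep_order rr _ p1.
- exact: orth_rep_order rr _ p1.
- by rewrite Hb Ha -mulmxA -rD addrC subrK.
- by rewrite Hc Ha -mulmxA -rD addrC subrK.
Qed.

Lemma circle_orbit p (a b c : 'rV[R]_3) :
  a ord0 i3 = 0 -> b ord0 i3 = 0 -> c ord0 i3 = 0 ->
  dot a a = 1 -> dot b b = 1 -> dot c c = 1 ->
  dot a b ^+ 2 != 1 -> dot a c ^+ 2 != 1 -> dot b c ^+ 2 != 1 -> prime p ->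
  sub_p_toral p (fun x => x = a \/ x = b \/ x = c) ->
  exists2 j : nat, b = a *m rotz (2 * pi * j%:R / p%:R) &
    exists k : nat, c = a *m rotz (2 * pi * k%:R / p%:R).
Proof.
move=> a3 b3 c3 aa bb cc ab ac bc pp.
move=> /(sub_p_toral_translates pp)[m [M [K [MK Mp Kp Hb Hc]]]].
have a0 : row_mx a 0 != 0 :> 'rV[R]_(3 + m).
  apply/eqP => /(congr1 (fun v => dot v v)).
  by rewrite dot_row_mx !dot0l aa addr0; apply/eqP; rewrite oner_eq0.
pose x := dot a b; pose x' := dot a c.
set a1 := a ord0 ord0; set a2 := a ord0 (lift ord0 ord0).
(* [(x, y)] and [(x', y')] are the coordinates of [b] and [c] in the orthonormal frame formed by [a]
   and its quarter turn. *)
pose y := a1 * b ord0 (lift ord0 ord0) - a2 * b ord0 ord0.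
pose y' := a1 * c ord0 (lift ord0 ord0) - a2 * c ord0 ord0.
have a12 : a1 ^+ 2 + a2 ^+ 2 = 1 by rewrite -aa dot3E a3 /a1 /a2; ring.
have xE : x = a1 * b ord0 ord0 + a2 * b ord0 (lift ord0 ord0).
  by rewrite /x dot3E a3 mul0r addr0.
have xE' : x' = a1 * c ord0 ord0 + a2 * c ord0 (lift ord0 ord0).
  by rewrite /x' dot3E a3 mul0r addr0.
have b1 : b ord0 ord0 = x * a1 - y * a2.
  by rewrite -[LHS]mul1r -a12 xE /y; ring.
have b2 : b ord0 (lift ord0 ord0) = x * a2 + y * a1.
  by rewrite -[LHS]mul1r -a12 xE /y; ring.
have c1 : c ord0 ord0 = x' * a1 - y' * a2.
  by rewrite -[LHS]mul1r -a12 xE' /y'; ring.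
have c2 : c ord0 (lift ord0 ord0) = x' * a2 + y' * a1.
  by rewrite -[LHS]mul1r -a12 xE' /y'; ring.
have xy : x ^+ 2 + y ^+ 2 = 1.
  by rewrite -bb -[LHS]mulr1 -{1}a12 dot3E b3 b1 b2; ring.
have xy' : x' ^+ 2 + y' ^+ 2 = 1.
  by rewrite -cc -[LHS]mulr1 -{1}a12 dot3E c3 c1 c2; ring.
have bcE : dot b c = x * x' + y * y'.
  by rewrite -[RHS]mulr1 -a12 dot3E b3 c3 b1 b2 c1 c2; ring.
have y0 : y != 0 by apply: contraNneq ab => y0; rewrite -/x -xy y0 expr0n addr0.
have y0' : y' != 0 by apply: contraNneq ac => y0''; rewrite -/x' -xy' y0'' expr0n addr0.
pose mu := y' / y.
have yE : y' = mu * y by rewrite /mu divfK.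
have mu0 : mu != 0 by rewrite mulf_neq0 ?invr_eq0.
clearbody mu; pose la := x' - mu * x.
(* Otherwise [c] would be [b] or [-b]. *)
have la0 : la != 0.
  apply: contraNneq bc => la0.
  have x'E : x' = mu * x by move: la0; rewrite /la; lra.
  have m2 : mu ^+ 2 = 1 by rewrite -xy' x'E yE -[LHS]mulr1 -xy; ring.
  have -> : dot b c = mu * (x ^+ 2 + y ^+ 2) by rewrite bcE x'E yE; ring.
  by rewrite xy mulr1 m2.
have cE : c = la *: a + mu *: b.
  apply: rowP3; rewrite !mxE ?a3 ?b3 ?c3 ?c1 ?c2 ?b1 ?b2 -?/a1 -?/a2 /la ?yE; ring.
have rel : row_mx a 0 *m K = la *: row_mx a 0 + mu *: (row_mx a 0 *m M).
  by rewrite -Hc -Hb !scale_row_mx add_row_mx !scaler0 addr0 -cE.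
(* The dimension [3 + m] is read as [(2 + m).+1]. The roots [w] and la + mu w get the arguments [th]
   and [ph]. *)
have [w [/(unity_root_cis pp)[j wE]]] :=
  @orbit_relation R (2 + m) p M K (row_mx a 0) la mu pp MK Mp Kp a0 rel.
move/(unity_root_cis pp) => [k]; rewrite wE => -[].
set th := _ / _; set ph := _ / _.
rewrite !mul0r !subr0 !addr0 !add0r => ck sk.
(* Both la + mu e^(i th) and la + mu (x + i y) have modulus 1. With [la] and [mu] nonzero, the
   modulus of la + mu e^(i t) determines cos t. *)
have cj : cos th = x.
  have E : 2 * (la * mu) * (cos th - x) = 0.
    have : cos ph ^+ 2 + sin ph ^+ 2 = x' ^+ 2 + y' ^+ 2 by rewrite cos2Dsin2 xy'.
    rewrite -ck -sk yE (_ : x' = la + mu * x); last by rewrite /la; ring.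
    move=> h; have s2 := sin2cos2 th.
    have e1 : y ^+ 2 = 1 - x ^+ 2 by lra.
    have : (la + mu * cos th) ^+ 2 + mu ^+ 2 * sin th ^+ 2 =
        (la + mu * x) ^+ 2 + mu ^+ 2 * y ^+ 2.
      by lra.
    by rewrite s2 e1; lra.
  move/eqP: E; rewrite !mulf_eq0 (negPf la0) (negPf mu0) pnatr_eq0 subr_eq0.
  by move/eqP.
have /eqP : sin th ^+ 2 = y ^+ 2 by rewrite sin2cos2 cj; lra.
have cph : cos ph = x' by rewrite -ck cj /la; ring.
(* If [sin th = y], the angles [th] and [ph] carry [a] to [b] and [c]; in the conjugate case the
   opposite angles do. *)
rewrite eqf_sqr => /orP[/eqP sj|/eqP sj].
  exists j; last exists k; apply: mul_rotz; rewrite ?a3 ?b3 ?c3 //.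
  - by rewrite b1 -/th -/a1 -/a2 cj sj; ring.
  - by rewrite b2 -/th -/a1 -/a2 cj sj; ring.
  - by rewrite c1 -/ph -/a1 -/a2 cph -sk sj -yE; ring.
  - by rewrite c2 -/ph -/a1 -/a2 cph -sk sj -yE; ring.
exists (p.-1 * j)%N; last exists (p.-1 * k)%N;
  rewrite -rotz_opp ?prime_gt0 //; apply: mul_rotz; rewrite ?a3 ?b3 ?c3 // cosN sinN.
- by rewrite b1 -/th -/a1 -/a2 cj sj; ring.
- by rewrite b2 -/th -/a1 -/a2 cj sj; ring.
- by rewrite c1 -/ph -/a1 -/a2 cph -sk sj yE; ring.
- by rewrite c2 -/ph -/a1 -/a2 cph -sk sj yE; ring.
Qed.

Lemma unit_dot_sqr_neq1 k (u v : 'rV[R]_k) : dot u u = 1 -> dot v v = 1 ->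
  u != v -> v <> - u -> dot u v ^+ 2 != 1.
Proof.
move=> uu vv uv uNv; rewrite sqrf_eq1; apply/norP; split.
  by apply: contraNneq uv => /(unit_eq uu vv) ->.
by apply/eqP => /(unit_antipodal uu vv).
Qed.

End Circle.

Unset Implicit Arguments.
Set Strict Implicit.

Theorem theorem8 (R : realType) (a b c : 'rV[R]_3) :
  a != b -> a != c -> b != c ->
  dot a a = 1 -> dot b b = 1 -> dot c c = 1 ->
  let X := fun x : 'rV[R]_3 => x = a \/ x = b \/ x = c in
  ((~ exists l1 l2 l3 : R, l1 + l2 + l3 = 1 /\ l1 *: a + l2 *: b + l3 *: c = 0) ->
     exists N : nat, forall p : nat, prime p -> (N <= p)%N -> sub_p_toral p X) /\
  (a ord0 i3 = 0 -> b ord0 i3 = 0 -> c ord0 i3 = 0 ->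
     ((exists p : nat, prime p /\ sub_p_toral p X) <->
      (right_triangle a b c \/
       exists p : nat, prime p /\
         exists x0 : 'rV[R]_3, forall x, X x ->
           exists j : nat, x = x0 *m rotz (2 * pi * j%:R / p%:R)))).
Proof.
move=> ab ac bc aa bb cc X; split; first exact: sub_p_toral_large.
move=> a3 b3 c3; split=> [[p [pp sX]]|[rt|[p [pp [x0 Hx0]]]]]; first last.
- by exists p; split=> //; apply: rotz_orbit_sub_p_toral Hx0; exact: prime_gt1.
- by exists 2%N; split=> //; exact: right_triangle_sub_2_toral.
(* Without an antipodal pair, the given prime [p] itself works, with base point [a]. *)
have [anti|nanti] := pselect (b = - a \/ c = - a \/ c = - b).
  by left; exact: antipodal_right_triangle.
right; exists p; split=> //; exists a.
have [|||j bE [k cE]] := circle_orbit a3 b3 c3 aa bb cc _ _ _ pp sX.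
- by apply: unit_dot_sqr_neq1 => // h; apply: nanti; left.
- by apply: unit_dot_sqr_neq1 => // h; apply: nanti; right; left.
- by apply: unit_dot_sqr_neq1 => // h; apply: nanti; right; right.
move=> x [->|[->|->]]; [|by exists j|by exists k].
by exists 0%N; rewrite mulr0 mul0r rotz0 mulmx1.
Qed.
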